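(* Let $G$ be a finite group of order $n$, let $K$ be a finite field, and let $C=zKG$, with $z=z^2=\hat z\in KG$, be an LCD group code of dimension $k$ in $KG$. Let $N$ be the maximal number of linearly independent right zero divisors of $z$. Then $n-k=N$, and hence $d(C)\leq N+1$. If moreover $C$ is an MDS code, then $d(C)=N+1$.
   Context: For a finite field $K$ and a finite group $G$, $KG=\{\sum_{g\in G}a_g g : a_g\in K\}$ is the group algebra with its usual addition and multiplication. For $a=\sum_g a_g g\in KG$, the adjoint is $\hat a=\sum_g a_g g^{-1}$. A group code is a right ideal $C$ of $KG$, viewed as a linear code of length $n=|G|$ over $K$ with weight $wt(a)=|\{g\in G: a_g\neq 0\}|$. The minimum distance $d(C)$ is the minimum weight of a nonzero element of $C$. The inner product on $KG$ is $\langle a,b\rangle=\sum_{g\in G}a_g b_g$, and $C^\perp=\{b\in KG:\langle a,b\rangle=0\ \forall a\in C\}$. $C$ is LCD (linear complementary dual) if $C\cap C^\perp=\{0\}$. $C$ is MDS (maximum distance separable) if $d(C)=n-\dim_K(C)+1$. A right zero divisor of $z$ means an element $a\in KG$ with $z\cdot a=0$; linear independence is over $K$. *)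

(* Defs.v *)
From HB Require Import structures.
From mathcomp Require Import all_boot all_order all_fingroup all_algebra all_field.

Set Implicit Arguments.
Unset Strict Implicit.
Unset Printing Implicit Defensive.

Import GRing.Theory.
Local Open Scope ring_scope.

(* An alias of [{ffun G -> K}], needed because that type already carries the
   pointwise product; here the product is the convolution. *)
Definition group_algebra (K : finFieldType) (G : finGroupType) : Type :=
  {ffun G -> K}.

Section GroupAlgebra.
Variables (K : finFieldType) (G : finGroupType).
Local Notation KG := (group_algebra K G).

HB.instance Definition _ := Finite.copy KG {ffun G -> K}.
HB.instance Definition _ := GRing.Zmodule.copy KG {ffun G -> K}.
HB.instance Definition _ := GRing.Lmodule.copy KG {ffun G -> K^o}.
HB.instance Definition _ := Vector.copy KG {ffun G -> K^o}.

Implicit Types a b c : KG.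

Definition ga_elt (x : G) : KG := [ffun g => (g == x)%:R].

Definition ga_mul a b : KG := [ffun g => \sum_(h : G) a h * b (h^-1 * g)%g].

Lemma ga_mulA : associative ga_mul.
Proof.
move=> a b c; apply/ffunP=> g; rewrite !ffunE.
under eq_bigr do rewrite ffunE mulr_sumr.
under [RHS]eq_bigr do rewrite ffunE mulr_suml.
rewrite [RHS]exchange_big /=; apply: eq_bigr => h _.
rewrite [RHS](reindex_inj (mulgI h)) /=; apply: eq_bigr => x _.
by rewrite mulKg invMg !mulgA mulrA.
Qed.

Lemma ga_mul1l : left_id (ga_elt 1) ga_mul.
Proof.
move=> a; apply/ffunP=> g; rewrite ffunE (bigD1 1%g) //= ffunE eqxx mul1r.
rewrite invg1 mul1g big1 ?addr0 // => h /negPf h1.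
by rewrite ffunE h1 mul0r.
Qed.

Lemma ga_mul1r : right_id (ga_elt 1) ga_mul.
Proof.
move=> a; apply/ffunP=> g; rewrite ffunE (bigD1 g) //= ffunE mulVg eqxx mulr1.
rewrite big1 ?addr0 // => h /negPf hg.
by rewrite ffunE -eq_mulVg1 hg mulr0.
Qed.

Lemma ga_mulDl : left_distributive ga_mul +%R.
Proof.
move=> a b c; apply/ffunP=> g; rewrite !ffunE -big_split /=.
by apply: eq_bigr => h _; rewrite ffunE mulrDl.
Qed.

Lemma ga_mulDr : right_distributive ga_mul +%R.
Proof.
move=> a b c; apply/ffunP=> g; rewrite !ffunE -big_split /=.
by apply: eq_bigr => h _; rewrite ffunE mulrDr.
Qed.

Lemma ga_elt1_neq0 : ga_elt 1 != 0.
Proof.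
apply/eqP=> /ffunP/(_ 1%g); rewrite !ffunE eqxx => /eqP.
by rewrite oner_eq0.
Qed.

HB.instance Definition _ := GRing.Zmodule_isNzRing.Build KG
  ga_mulA ga_mul1l ga_mul1r ga_mulDl ga_mulDr ga_elt1_neq0.

Lemma ga_scaleAl (x : K) a b : x *: (a * b) = (x *: a) * b.
Proof.
apply/ffunP=> g; rewrite !ffunE scaler_sumr.
by apply: eq_bigr => h _; rewrite ffunE scalerAl.
Qed.

HB.instance Definition _ := GRing.Lmodule_isLalgebra.Build K KG ga_scaleAl.

Lemma ga_scaleAr (x : K) a b : x *: (a * b) = a * (x *: b).
Proof.
apply/ffunP=> g; rewrite !ffunE scaler_sumr.
by apply: eq_bigr => h _; rewrite ffunE scalerAr.
Qed.

HB.instance Definition _ := GRing.Lalgebra_isAlgebra.Build K KG ga_scaleAr.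
HB.instance Definition _ := Algebra_isFalgebra.Build K KG.

Implicit Types C : {vspace KG}.

Definition adjoint a : KG := [ffun g => a g^-1%g].

Definition wt a : nat := #|[set g | a g != 0]|.

Definition inner a b : K := \sum_(g : G) a g * b g.

Definition dual C : {set KG} := [set b | [forall a in C, inner a b == 0]].

(* Right ideals of KG are K-subspaces, so group codes are taken among
   [{vspace KG}]. *)
Definition group_code C : Prop := forall a b, a \in C -> a * b \in C.

Definition LCD C : Prop := [set a in C] :&: dual C = [set 0].

(* [vpick C] is a nonzero element of C whenever C is nonzero. The zero code has
   no nonzero word; its minimum distance takes the default value [wt 0 = 0]. *)
Definition min_dist C : nat :=
  wt [arg min_(c < vpick C | (c \in C) && (c != 0)) wt c].

Definition MDS C : Prop := min_dist C = (#|G| - \dim C + 1)%N.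

Definition right_zero_divisors z : {set KG} := [set a | z * a == 0].

Definition max_indep (A : {set KG}) : nat :=
  \max_(X : {set KG} | (X \subset A) && free (enum X)) #|X|.

End GroupAlgebra.

(* Main.v *)
Require Import Defs.
From HB Require Import structures.
From mathcomp Require Import all_boot all_order all_fingroup all_algebra all_field.

Import GRing.Theory.
Local Open Scope ring_scope.

(** Left multiplication by [z] is a linear endomorphism of the [n]-dimensional
    space [KG], with image [C] and with kernel exactly the set of right zero
    divisors of [z]. A largest independent family in a subspace is a basis of
    it, so [N] is the dimension of that kernel and rank-nullity gives
    [n - k = N] ([max_indep_right_zero_divisors], [dim_right_ideal]).

    What is left is the Singleton bound [d <= n - k + 1]: asking a codeword to
    vanish at [k - 1] chosen positions imposes [k - 1] linear conditions on a
    [k]-dimensional space, so some nonzero codeword survives, and its support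
    avoids these positions ([exists_low_weight]). The zero code, to which this
    does not apply, has minimum distance [0] by convention, so it satisfies the
    bound too. The MDS clause only restates the definition with [n - k = N]. *)

Lemma dim_group_algebra (K : finFieldType) (G : finGroupType) :
  \dim {:group_algebra K G} = #|G|.
Proof. by rewrite dimvf /dim /= muln1. Qed.

(** An independent set inside [U] has at most [\dim U] elements, and the set of
    vectors of a basis of [U] attains this bound. *)
Lemma max_indep_subspace (K : finFieldType) (G : finGroupType)
    (U : {vspace group_algebra K G}) :
  max_indep [set a in U] = \dim U.
Proof.
apply/eqP; rewrite eqn_leq; apply/andP; split.
  apply/bigmax_leqP=> X /andP[/subsetP XU freeX].
  rewrite cardE -(eqP freeX); apply: dimvS; apply/span_subvP=> x.
  by rewrite mem_enum => /XU; rewrite inE.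
have basisU := vbasisP U.
have permB : perm_eq (enum [set x in vbasis U]) (vbasis U).
  apply: uniq_perm; first exact: enum_uniq.
    exact: free_uniq (basis_free basisU).
  by move=> x; rewrite mem_enum inE.
have cardB : #|[set x in vbasis U]| = \dim U.
  by rewrite cardE (perm_size permB) size_tuple.
rewrite -{1}cardB.
apply: (leq_bigmax_cond (F := fun X : {set group_algebra K G} => #|X|)).
rewrite (perm_free permB) (basis_free basisU) andbT.
by apply/subsetP=> x; rewrite !inE; apply: vbasis_mem.
Qed.

Lemma right_zero_divisors_lker (K : finFieldType) (G : finGroupType)
    (z : group_algebra K G) :
  right_zero_divisors z = [set a in lker (amull z)].
Proof. by apply/setP=> a; rewrite !inE memv_ker lfunE. Qed.

Lemma max_indep_right_zero_divisors (K : finFieldType) (G : finGroupType)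
    (z : group_algebra K G) :
  max_indep (right_zero_divisors z) = \dim (lker (amull z)).
Proof. by rewrite right_zero_divisors_lker max_indep_subspace. Qed.

Lemma dim_right_ideal (K : finFieldType) (G : finGroupType)
    (z : group_algebra K G) :
  (\dim (lker (amull z)) + \dim (limg (amull z)))%N = #|G|.
Proof. by rewrite -[in LHS](capfv (lker _)) limg_ker_dim dim_group_algebra. Qed.

Definition restrict_word {K : finFieldType} {G : finGroupType} {m : nat}
    (p : 'I_m -> G) (a : group_algebra K G) : 'rV[K]_m :=
  \row_j a (p j).

Lemma restrict_word_linear (K : finFieldType) (G : finGroupType) (m : nat)
    (p : 'I_m -> G) : linear (@restrict_word K G m p).
Proof. by move=> x a b; apply/rowP=> j; rewrite !(mxE, ffunE). Qed.

HB.instance Definition _ (K : finFieldType) (G : finGroupType) (m : nat)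
    (p : 'I_m -> G) :=
  GRing.isLinear.Build K (group_algebra K G) 'rV[K]_m *:%R (@restrict_word K G m p)
    (@restrict_word_linear K G m p).

(** Reading a word at [m] distinct positions is a linear map into a space of
    dimension [m], hence not injective on [C] when [m < \dim C]; a nonzero word
    of its kernel vanishes at these [m] positions. *)
Lemma exists_low_weight (K : finFieldType) (G : finGroupType)
    (C : {vspace group_algebra K G}) (m : nat) (mC : (m < \dim C)%N) :
  exists c, [/\ c \in C, c != 0 & (wt c <= #|G| - m)%N].
Proof.
have mG : (m <= #|G|)%N.
  by rewrite (leq_trans (ltnW mC)) // -(dim_group_algebra K) dimvS ?subvf.
pose p (j : 'I_m) : G := enum_val (widen_ord mG j).
have p_inj : injective p by move=> i j /enum_val_inj [] /val_inj.
pose f : 'Hom(group_algebra K G, 'rV[K]_m) := linfun (restrict_word p).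
have dim_im : (\dim (f @: C) <= m)%N.
  by rewrite (leq_trans (dimvS (subvf _))) // dimvf /dim /= mul1n.
have ker_neq0 : (C :&: lker f)%VS != 0%VS.
  rewrite -dimv_eq0 -lt0n -(ltn_add2r (\dim (f @: C))) limg_ker_dim.
  exact: leq_ltn_trans mC.
exists (vpick (C :&: lker f)).
have := memv_pick (C :&: lker f)%VS.
rewrite memv_cap memv_ker lfunE => /andP[-> /eqP/rowP c_p].
rewrite vpick0 ker_neq0; split=> //.
have -> : (#|G| - m)%N = #|~: [set p j | j : 'I_m]|.
  by rewrite [RHS]cardsCs setCK card_imset ?card_ord.
apply/subset_leq_card/subsetP=> g.
rewrite !inE; apply: contraNN => /imsetP[j _ ->].
by have := c_p j; rewrite !mxE => ->.
Qed.

Lemma min_dist_le_wt (K : finFieldType) (G : finGroupType)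
    (C : {vspace group_algebra K G}) (c : group_algebra K G)
    (cC : c \in C) (c0 : c != 0) :
  (min_dist C <= wt c)%N.
Proof.
rewrite /min_dist; case: arg_minnP => [|d _]; last by apply; rewrite cC.
rewrite memv_pick vpick0; apply: contraNneq c0 => C0.
by rewrite -memv0 -C0.
Qed.

Lemma min_dist0 (K : finFieldType) (G : finGroupType) :
  min_dist (0%VS : {vspace group_algebra K G}) = 0%N.
Proof.
rewrite /min_dist /arg_min /extremum; case: pickP => [c /andP[]|_] /=.
  by rewrite memv0 andbN.
have /eqP -> : vpick (0%VS : {vspace group_algebra K G}) == 0 by rewrite vpick0.
by apply: eq_card0 => g; rewrite !inE ffunE eqxx.
Qed.

Lemma singleton_bound (K : finFieldType) (G : finGroupType)
    (C : {vspace group_algebra K G}) :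
  (min_dist C <= #|G| - \dim C + 1)%N.
Proof.
have [-> | C0] := eqVneq C 0%VS; first by rewrite min_dist0.
have dimC : (0 < \dim C)%N by rewrite lt0n dimv_eq0.
have [|c [cC c0 /(leq_trans (min_dist_le_wt _ _ _ _ cC c0))]] :=
  @exists_low_weight K G C (\dim C).-1; first by rewrite prednK.
move=> /leq_trans; apply.
by rewrite -[in leqRHS](prednK dimC) subnS addn1 leqSpred.
Qed.

Theorem corollary6 (G : finGroupType) (n : nat) (hn : #|G| = n)
    (K : finFieldType) (z : group_algebra K G)
    (hz2 : z = z ^+ 2) (hzadj : z = adjoint z)
    (C : {vspace (group_algebra K G)}) (hC : C = limg (amull z))
    (hcode : group_code C) (hLCD : LCD C)
    (k : nat) (hk : \dim C = k)
    (N : nat) (hN : N = max_indep (right_zero_divisors z)) :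
  [/\ (n - k)%N = N,
      (min_dist C <= N + 1)%N
    & MDS C -> min_dist C = (N + 1)%N].
Proof.
have codim : (n - k)%N = N.
  by rewrite hN max_indep_right_zero_divisors -hn -hk hC -(dim_right_ideal _ _ z) addnK.
by split=> //; rewrite -codim -hn -hk //; apply: singleton_bound.
Qed.
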